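(* For every $k,a\ge 1$ and $p\ge 2$, there exists $\delta>0$ such that for all large $n$ and $b\le \delta\ln n$, $$r(K_p(1,a,b,\dots,b),B_{k,n})\le (p-1)(n-1)+k(p-1)(a-1)+1.$$ The equality holds if $a\mid(n-1-k)$.
   Context: Here $k,a,p,n,b$ are positive integers, and $a\mid(n-1-k)$ means that $a$ divides $n-1-k$. For graphs $H_1,H_2$, the Ramsey number $r(H_1,H_2)$ is the smallest positive integer $N$ such that for every graph $G$ on $N$ vertices, either $G$ contains $H_1$ as a (not necessarily induced) subgraph or the complement $\overline{G}$ contains $H_2$ as a subgraph. $K_p(a_1,\dots,a_p)$ is the complete $p$-partite graph with parts of sizes $a_1,\dots,a_p$, so $K_p(1,a,b,\dots,b)$ has one part of size $1$, one part of size $a$ and $p-2$ parts of size $b$ (it is the star $K_{1,a}$ when $p=2$). $B_{k,n}$ is the book graph on $n$ vertices consisting of $n-k$ copies of $K_{k+1}$ all sharing a common $K_k$ (i.e. a clique on $k$ vertices together with $n-k$ further vertices, pairwise non-adjacent, each adjacent to all $k$ vertices of the clique).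
   Formalization: The equality clause is stated only for p = 2 or a ≤ b; for p ≥ 3 and b < a it is false for large n, e.g. K_3(1,2,1) = K_3(1,1,2) gives r ≤ 2(n-1)+1 < 2(n-1)+2k+1. *)

(* Defs.v *)
From mathcomp Require Import all_boot.
From mathcomp Require Import boolp.

Set Implicit Arguments.
Unset Strict Implicit.
Unset Printing Implicit Defensive.

(* Finite simple graphs. *)
Record sgraph := SGraph {
  vertex :> finType;
  adj : rel vertex;
  adj_sym : symmetric adj;
  adj_irr : irreflexive adj
}.

Section Complement.
Variable G : sgraph.

Definition compl_adj : rel G := fun x y => (x != y) && ~~ adj x y.

Lemma compl_adj_sym : symmetric compl_adj.
Proof. by move=> x y; rewrite /compl_adj eq_sym adj_sym. Qed.

Lemma compl_adj_irr : irreflexive compl_adj.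
Proof. by move=> x; rewrite /compl_adj eqxx. Qed.

Definition compl : sgraph := SGraph compl_adj_sym compl_adj_irr.
End Complement.

(* Subgraph containment, not necessarily induced. *)
Definition contains (G H : sgraph) : Prop :=
  exists2 f : H -> G, injective f & forall x y, adj x y -> adj (f x) (f y).

Definition arrows (N : nat) (H1 H2 : sgraph) : Prop :=
  forall G : sgraph, #|G| = N -> contains G H1 \/ contains (compl G) H2.

Lemma ramsey_cliques (s t : nat) : exists N, forall (G : sgraph) (A : {set G}),
  N <= #|A| ->
     (exists2 S : {set G}, S \subset A & #|S| = s /\ 
        {in S &, forall x y, x != y -> adj x y})
  \/ (exists2 S : {set G}, S \subset A & #|S| = t /\ 
        {in S &, forall x y, x != y -> ~~ adj x y}).
Proof.
have [m] := ubnP (s + t); elim: m s t => // m IHm [|s] [|t] lt_m;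
  try by exists 0 => G A _; (left + right); exists set0;
    rewrite ?sub0set ?cards0 //; split=> // x y; rewrite inE.
have [|N1 HN1] := IHm s t.+1; first by rewrite addSn in lt_m.
have [|N2 HN2] := IHm s.+1 t; first by rewrite addnS in lt_m.
exists (N1 + N2).+1 => G A lt_N.
have /card_gt0P[x xA] : 0 < #|A| by apply: leq_ltn_trans lt_N.
pose A1 := [set y in A :\ x | adj x y]; pose A2 := [set y in A :\ x | ~~ adj x y].
have A1x y : y \in A1 -> [/\ y != x, y \in A & adj x y].
  by rewrite !inE => /andP[/andP[-> ->] ->].
have A2x y : y \in A2 -> [/\ y != x, y \in A & ~~ adj x y].
  by rewrite !inE => /andP[/andP[-> ->] ->].
have A1A : A1 \subset A by apply/subsetP => y /A1x[].
have A2A : A2 \subset A by apply/subsetP => y /A2x[].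
have cardA : #|A1| + #|A2| = #|A|.-1.
  rewrite (cardsD1 x A) xA add1n /= -(cardsID [set y | adj x y] (A :\ x)).
  by congr (_ + _); congr #|pred_of_set _|; apply/setP => y; rewrite !inE // andbC.
have [leN1|ltN1] := leqP N1 #|A1|.
  have [[S SA [cS adjS]]|[S SA HS]] := HN1 G A1 leN1; last first.
    by right; exists S => //; apply: subset_trans A1A.
  left; exists (x |: S).
    by rewrite subUset sub1set xA (subset_trans SA A1A).
  split.
    rewrite cardsU1 cS; have [/(subsetP SA _)/A1x[]|//] := boolP (x \in S).
    by rewrite eqxx.
  move=> y z /setU1P[->|yS] /setU1P[->|zS]; rewrite ?eqxx //; last exact: adjS.
    by have []// := A1x _ (subsetP SA _ zS).
  by rewrite adj_sym; have []// := A1x _ (subsetP SA _ yS).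
have leN2 : N2 <= #|A2|.
  rewrite -(leq_add2l N1); apply: leq_trans (leq_add (ltnW ltN1) (leqnn _)).
  by rewrite cardA -ltnS (ltn_predK lt_N).
have [[S SA HS]|[S SA [cS adjS]]] := HN2 G A2 leN2.
  by left; exists S => //; apply: subset_trans A2A.
right; exists (x |: S).
  by rewrite subUset sub1set xA (subset_trans SA A2A).
split.
  rewrite cardsU1 cS; have [/(subsetP SA _)/A2x[]|//] := boolP (x \in S).
  by rewrite eqxx.
move=> y z /setU1P[->|yS] /setU1P[->|zS]; rewrite ?eqxx //; last exact: adjS.
  by have []// := A2x _ (subsetP SA _ zS).
by rewrite adj_sym; have []// := A2x _ (subsetP SA _ yS).
Qed.

Lemma contains_clique (G H : sgraph) (S : {set G}) :
  #|S| = #|H| -> {in S &, forall x y, x != y -> adj x y} -> contains G H.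
Proof.
move=> cS adjS; pose f (x : H) : G := enum_val (cast_ord (esym cS) (enum_rank x)).
have f_inj : injective f.
  by move=> x y /enum_val_inj/cast_ord_inj/enum_rank_inj.
exists f => // x y xy; apply: adjS; rewrite ?enum_valP //.
by apply: contraTneq xy => /f_inj ->; rewrite adj_irr.
Qed.

Lemma ramsey_exists (H1 H2 : sgraph) :
  exists N, (0 < N) && `[< arrows N H1 H2 >].
Proof.
have [N HN] := ramsey_cliques #|H1| #|H2|; exists N.+1 => /=.
apply/asboolP => G cG.
have [|[S _ [cS adjS]]|[S _ [cS adjS]]] := HN G setT.
- by rewrite cardsT cG.
- by left; apply: contains_clique adjS.
- right; apply: (@contains_clique (compl G) H2 S) => // x y xS yS xy.
  by rewrite /= /compl_adj xy adjS.
Qed.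

Definition ramsey (H1 H2 : sgraph) : nat := ex_minn (ramsey_exists H1 H2).

(* The complete multipartite graph whose part sizes are listed by s. *)
Section CompleteMultipartite.
Variable s : seq nat.

Definition multipartite_vertex : finType :=
  {i : 'I_(size s) & 'I_(nth 0 s i)}.

Definition multipartite_adj : rel multipartite_vertex :=
  fun u v => tag u != tag v.

Lemma multipartite_adj_sym : symmetric multipartite_adj.
Proof. by move=> u v; rewrite /multipartite_adj eq_sym. Qed.

Lemma multipartite_adj_irr : irreflexive multipartite_adj.
Proof. by move=> u; rewrite /multipartite_adj eqxx. Qed.

Definition complete_multipartite : sgraph :=
  SGraph multipartite_adj_sym multipartite_adj_irr.
End CompleteMultipartite.

(* The book B_{k,n}, for k <= n: the vertices below k form the common clique. *)
Section Book.
Variables k n : nat.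

Definition book_adj : rel 'I_n :=
  fun i j => (i != j) && ((i < k) || (j < k)).

Lemma book_adj_sym : symmetric book_adj.
Proof. by move=> i j; rewrite /book_adj eq_sym orbC. Qed.

Lemma book_adj_irr : irreflexive book_adj.
Proof. by move=> i; rewrite /book_adj eqxx. Qed.

Definition book : sgraph := SGraph book_adj_sym book_adj_irr.
End Book.

(* Main.v *)
(** Write q = p - 1 and let H be the multipartite graph. If G has more than
    q(n-1) vertices, no copy of H, and no book in its complement, then in every
    independent set T all but about n vertices have positive density to T. By
    Ramsey and the pigeonhole principle on neighborhoods this yields q independent,
    mutually completely joined sets T_0, ..., T_(q-1) of common size L, where L is a
    large constant multiple of b.

    Average over the independent k-subsets of each T_i the number of common
    non-neighbors, which is at most n-1, and sum over i: a vertex w contributes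
    the sum over i of C(L - d_i(w), k) / C(L, k), where d_i(w) is its degree into
    T_i. Since H is not in G, some d_i(w) is below ab. If w also misses a
    proportion 1/(2a) of another T_j, the term of T_j alone compensates the loss
    in the term of T_i, so w contributes at least 1. The total loss of the
    remaining, "perfect", vertices is at most k(a-1) for each i, because a vertex
    of T_i with a perfect neighbors attached to T_i would extend to H. Hence
    |G| <= q(n-1) + kq(a-1).

    For the lower bound, join completely q disjoint unions of copies of K_a. *)

Require Import Defs.
From mathcomp Require Import all_boot all_order all_algebra.
From mathcomp Require Import reals exp.
From mathcomp Require Import boolp zify ring.

Set Implicit Arguments.
Unset Strict Implicit.
Unset Printing Implicit Defensive.

Import Order.TTheory GRing.Theory Num.Theory.

(** * Neighborhoods, Ramsey with an explicit bound, and multipartite subgraphs *)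

Definition nbrs (G : sgraph) (w : G) : {set G} := [set x | adj w x].

Definition independent (G : sgraph) (S : {set G}) : Prop :=
  {in S &, forall x y, ~~ adj x y}.

Definition fully_joined (G : sgraph) (A B : {set G}) : Prop :=
  {in A & B, forall x y, adj x y}.

Definition first_of (T : finType) (d : nat) (A : {set T}) : {set T} :=
  [set x in take d (enum A)].

Lemma first_of_sub (T : finType) d (A : {set T}) : first_of d A \subset A.
Proof. by apply/subsetP => x; rewrite inE => /mem_take; rewrite mem_enum. Qed.

Lemma card_first_of (T : finType) d (A : {set T}) :
  d <= #|A| -> #|first_of d A| = d.
Proof.
move=> leA; rewrite cardsE (card_uniqP _) ?take_uniq ?enum_uniq //.
by rewrite size_takel // -cardE.
Qed.

(** The bound is singly exponential because [s] and [t] will be of order [b], which may grow like a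
    multiple of [ln n]. *)
Lemma ramsey_pow2 (G : sgraph) s t (A : {set G}) : 2 ^ (s + t) <= #|A| ->
     (exists2 S : {set G}, S \subset A & #|S| = s /\
        {in S &, forall x y, x != y -> adj x y})
  \/ (exists2 S : {set G}, S \subset A & #|S| = t /\ independent S).
Proof.
have [m] := ubnP (s + t); elim: m s t A => // m IHm [|s] [|t] A lt_m leA;
  try by (left + right); exists set0;
    rewrite ?sub0set ?cards0 //; split=> // x y; rewrite inE.
have /card_gt0P[x xA] : 0 < #|A| by apply: leq_trans leA; rewrite expn_gt0.
pose A1 := A :&: nbrs x; pose A0 := (A :\ x) :\: nbrs x.
have [A1A A0A] : A1 \subset A /\ A0 \subset A.
  by rewrite subsetIl; split=> //; apply: subset_trans (subD1set A x); apply: subsetDl.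
have cardA : (#|A1| + #|A0|).+1 = #|A|.
  rewrite (cardsD1 x A) xA -(cardsID (nbrs x) (A :\ x)) add1n; congr (_ + _).+1.
  apply: eq_card => y; rewrite !inE.
  by case: eqP => //= ->; rewrite adj_irr andbF.
have pow2S : 2 ^ (s.+1 + t.+1) = 2 ^ (s + t.+1) + 2 ^ (s.+1 + t).
  by rewrite !addnS !addSn expnS mul2n addnn.
have [le1|lt1] := leqP (2 ^ (s + t.+1)) #|A1|.
  case: (IHm _ _ _ _ le1) => [|[S SA [cS cl]]|[S SA ?]]; first lia; last first.
    by right; exists S => //; apply: subset_trans A1A.
  left; exists (x |: S); first by rewrite subUset sub1set xA (subset_trans SA).
  have xS y : y \in S -> adj x y.
    by move=> /(subsetP SA); rewrite !inE => /andP[].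
  split=> [|y z /setU1P[->|yS] /setU1P[->|zS]]; rewrite ?eqxx //; last exact: cl.
  - by rewrite cardsU1 cS; case: (boolP (x \in S)) => // /xS; rewrite adj_irr.
  - by move=> _; apply: xS.
  - by move=> _; rewrite adj_sym; apply: xS.
have le0 : 2 ^ (s.+1 + t) <= #|A0| by lia.
case: (IHm _ _ _ _ le0) => [|[S SA ?]|[S SA [cS ind]]]; first lia.
  by left; exists S => //; apply: subset_trans A0A.
right; exists (x |: S); first by rewrite subUset sub1set xA (subset_trans SA).
have xS y : y \in S -> (y != x) && ~~ adj x y.
  by move=> /(subsetP SA); rewrite !inE => /and3P[-> ->].
split=> [|y z /setU1P[->|yS] /setU1P[->|zS]]; last exact: ind.
- by rewrite cardsU1 cS; case: (boolP (x \in S)) => // /xS; rewrite eqxx.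
- by rewrite adj_irr.
- by have /andP[] := xS _ zS.
- by rewrite adj_sym; have /andP[] := xS _ yS.
Qed.

Lemma contains_multipartite (G : sgraph) (s : seq nat) (A : nat -> {set G}) :
  (forall i, i < size s -> nth 0 s i <= #|A i|) ->
  (forall i j, i < j < size s -> fully_joined (A i) (A j)) ->
  contains G (complete_multipartite s).
Proof.
move=> leA joinA.
have joined i j : i < size s -> j < size s -> i != j -> fully_joined (A i) (A j).
  move=> lti ltj; rewrite neq_ltn => /orP[ij|ji]; first by apply: joinA; lia.
  by move=> x y xA yA; rewrite adj_sym; apply: (joinA j i) => //; lia.
pose f (u : complete_multipartite s) : G :=
  let: existT i x := u in enum_val (widen_ord (leA i (ltn_ord i)) x).
have fA u : f u \in A (tag u) by case: u => i x; apply: enum_valP.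
have fadj u v : tag u != tag v -> adj (f u) (f v).
  by move=> neq; apply: (joined (tag u) (tag v)).
exists f => [u v|u v]; last exact: fadj.
have [|/fadj + fuv] := eqVneq (tag u) (tag v); last by rewrite fuv adj_irr.
case: u v => [i x] [j y] /= ij; case: j / ij y => y /enum_val_inj [] xy.
by congr existT; apply: val_inj.
Qed.

(** * Counting common non-neighbors of independent [k]-sets *)

(** Being independent, [S] lies in its own set [Z] of common non-neighbors. With [n] vertices in
    [Z], the complement has a book with spine [S] and pages in the rest of [Z]. *)
Lemma book_nonnbrs (G : sgraph) k n (S : {set G}) :
  0 < n -> ~ contains (compl G) (book k n) -> independent S -> #|S| = k ->
  #|[set w | [disjoint S & nbrs w]]| <= n - 1.
Proof.
move=> n0 nobook ind cS; rewrite leqNgt; apply: contra_notN nobook.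
set Z := [set w | _] => ltZ.
have SZ : S \subset Z.
  apply/subsetP => x xS; rewrite inE disjoint_subset; apply/subsetP => y yS.
  by rewrite !inE ind.
have /card_gt0P[x0 _] : 0 < #|Z| by lia.
pose e := enum S ++ enum (Z :\: S).
have ue : uniq e.
  rewrite cat_uniq !enum_uniq andbT /=; apply/hasPn => x.
  by rewrite !mem_enum inE => /andP[].
have eZ x : x \in e -> x \in Z.
  by rewrite mem_cat !mem_enum inE => /orP[/(subsetP SZ)|/andP[]].
have size_e : n <= size e.
  by rewrite size_cat -!cardE -(cardsID S Z) (setIidPr SZ) in ltZ *; lia.
pose f (i : book k n) : compl G := nth x0 e i.
have f_inj : injective f.
  move=> i j /eqP; rewrite nth_uniq ?(leq_trans (ltn_ord _) size_e) //.
  by move=> /eqP/val_inj.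
have fe i : f i \in Z by apply: eZ; rewrite mem_nth // (leq_trans (ltn_ord _)).
have fS (i : book k n) : i < k -> f i \in S.
  by move=> ik; rewrite /f nth_cat -cardE cS ik -mem_enum mem_nth // -cardE cS.
have adjZ x y : x \in S -> y \in Z -> ~~ adj (y : G) x.
  by move=> xS; rewrite inE => /disjointFr -/(_ _ xS); rewrite inE => ->.
exists f => // i j /= /andP[neq ltk]; rewrite /compl_adj (inj_eq f_inj) neq /=.
by case/orP: ltk => ltk; [rewrite adj_sym|]; apply: adjZ (fe _); apply: fS.
Qed.

(** Double counting of the pairs of a vertex [w] and a [k]-subset of [T] that avoids the neighbors
    of [w]. *)
Lemma sum_bin_nonnbrs (G : sgraph) k n (T : {set G}) :
  0 < n -> ~ contains (compl G) (book k n) -> independent T ->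
  \sum_w 'C(#|T :\: nbrs w|, k) <= (n - 1) * 'C(#|T|, k).
Proof.
move=> n0 nobook ind.
rewrite -cards_draws mulnC -sum_nat_const.
under eq_bigr => w _ do rewrite -cards_draws -sum1_card.
rewrite (exchange_big_dep (mem [set S : {set G} | S \subset T & #|S| == k])) /=.
  apply: leq_sum => S; rewrite !inE => /andP[ST /eqP cS].
  rewrite sum1_card; apply: leq_trans (book_nonnbrs n0 nobook _ cS); last first.
    by move=> x y /(subsetP ST) xT /(subsetP ST); apply: ind.
  apply: subset_leq_card; apply/subsetP => w; rewrite !inE.
  rewrite -[w \in _]/(S \in [set A : {set G} | A \subset T :\: nbrs w & #|A| == k]).
  by rewrite inE subsetD => /andP[/andP[]].
by move=> w S _; rewrite !inE subsetD => /andP[/andP[-> _] ->].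
Qed.

Lemma bin_sub_geq t d k :
  'C(t, k.+1) <= 'C(t - d, k.+1) + d * 'C(t.-1, k).
Proof.
elim: d => [|d IHd]; first by rewrite subn0 mul0n addn0.
apply: leq_trans IHd _; rewrite subnS mulSn addnA leq_add2r.
case E: (t - d) => [|r]; first by rewrite bin0n.
by rewrite binS leq_add2l leq_bin2l //=; lia.
Qed.

(** A vertex with fewer than [d] neighbors in [T] avoids at least a fraction
    [1 - k d / #|T| = 1 - 1 / (2 q)] of the [k]-subsets of [T]. *)
Lemma card_few_nbrs (G : sgraph) k n (T : {set G}) q d :
  0 < q -> 0 < k -> 0 < d -> 0 < n -> ~ contains (compl G) (book k n) ->
  independent T -> #|T| = 2 * q * k * d ->
  (2 * q - 1) * #|[set w | #|T :&: nbrs w| < d]| <= 2 * q * (n - 1).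
Proof.
case: k => // k q0 _ d0 n0 nobook ind cT; set D := [set w | _].
have t0 : 0 < #|T| by nia.
have C0 : 0 < 'C(#|T|, k.+1) by rewrite bin_gt0; nia.
have le1 : #|D| * ('C(#|T|, k.+1) - d * 'C(#|T|.-1, k)) <= (n - 1) * 'C(#|T|, k.+1).
  apply: leq_trans (sum_bin_nonnbrs n0 nobook ind).
  rewrite -sum_nat_const [leqRHS](bigID (mem D)) /=.
  apply: leq_trans (leq_addr _ _); apply: leq_sum => w; rewrite inE => ltd.
  rewrite leq_subLR addnC; apply: leq_trans (bin_sub_geq _ d _) _.
  rewrite leq_add2r leq_bin2l //.
  by have := cardsID (nbrs w) T; lia.
have le2 : #|D| * ((#|T| - k.+1 * d) * 'C(#|T|, k.+1))
         <= #|T| * ((n - 1) * 'C(#|T|, k.+1)).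
  apply: leq_trans (leq_mul (leqnn #|T|) le1).
  rewrite [leqRHS]mulnCA leq_mul2l mulnBr mulnBl (mulnCA #|T|) mul_bin_diag.
  by rewrite (mulnCA d) mulnA leqnn orbT.
move: le2; rewrite !mulnA leq_pmul2r // cT.
have -> : 2 * q * k.+1 * d - k.+1 * d = (2 * q - 1) * (k.+1 * d) by nia.
have kd : 0 < k.+1 * d by nia.
move=> le2; rewrite -(leq_pmul2r kd); move: le2.
by rewrite (mulnAC _ (n - 1)) (mulnC _ #|D|) !mulnA.
Qed.

(** * Construction of independent, completely joined sets *)

Definition joined_system (G : sgraph) (q d : nat) (T : nat -> {set G}) : Prop :=
  (forall i, i < q -> #|T i| = d /\ independent (T i)) /\
  (forall i j, i < q -> j < q -> i != j -> fully_joined (T i) (T j)).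

Lemma card_bigcup_leq (I T : finType) (F : I -> {set T}) :
  #|\bigcup_i F i| <= \sum_i #|F i|.
Proof.
elim/big_ind2: _ => [|A x B y leA leB|//]; first by rewrite cards0.
exact: leq_trans (leq_card_setU _ _) (leq_add leA leB).
Qed.

Lemma pigeonhole_fiber (T : finType) (U : {set T}) (Z : {set T})
    (phi : T -> {set T}) r :
  (forall w, w \in U -> phi w \subset Z) -> 2 ^ #|Z| * r < #|U| ->
  exists Q, r < #|[set w in U | phi w == Q]|.
Proof.
move=> phiZ ltU; apply/existsP; apply: contraTT ltU => /existsPn noQ.
rewrite -leqNgt -card_powerset -sum_nat_const -sum1_card.
rewrite (partition_big phi (mem (powerset Z))) /=; last first.
  by move=> w /phiZ; rewrite inE.
apply: leq_sum => Q _; have := noQ Q; rewrite -leqNgt; apply: leq_trans.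
by rewrite -sum1_card leq_eqVlt; apply/orP; left; apply/eqP/eq_bigl => w; rewrite inE.
Qed.

(** Each of the at most [q - 1] exceptional sets [D i] has at most [2 q (n - 1) / (2 q - 1)]
    vertices, so more than [q (n - 1) / (2 q - 1)] vertices remain, hence at least [n / 2]. *)
Lemma card_many_nbrs (G : sgraph) k n q d j (T : nat -> {set G}) :
  0 < k -> 0 < d -> 0 < n -> ~ contains (compl G) (book k n) ->
  q * (n - 1) + 1 <= #|G| -> j < q -> joined_system j (2 * q * k * d) T ->
  n <= 2 * #|[set w | [forall i : 'I_j, d <= #|T i :&: nbrs w|]]|.
Proof.
move=> k0 d0 n0 nobook leG ltj [Tsize _]; set U := [set w | _].
pose D i := [set w | #|T i :&: nbrs w| < d].
have leD : (2 * q - 1) * (\sum_(i < j) #|D i|) <= (q - 1) * (2 * q * (n - 1)).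
  rewrite big_distrr /=; apply: (@leq_trans (\sum_(i < j) 2 * q * (n - 1))).
    apply: leq_sum => i _; have [cT ind] := Tsize i (ltn_ord i).
    by apply: (card_few_nbrs (k := k)) => //; lia.
  by rewrite sum_nat_const card_ord leq_mul2r; apply/orP; right; lia.
have leU : #|G| <= #|U| + \sum_(i < j) #|D i|.
  rewrite -(cardsC U) leq_add2l; apply: leq_trans (card_bigcup_leq _).
  apply/subset_leq_card/subsetP => w; rewrite !inE negb_forall => /existsP[i lt].
  by apply/bigcupP; exists i => //; rewrite inE ltnNge.
move: leD (leq_trans leG leU); move: (\sum_(i < j) _) #|U| => x u {leU}.
case: q ltj {leG U D Tsize} => // r _; case: n n0 {nobook} => // n _.
rewrite !subn1 /= => leD leU; rewrite leqNgt; apply/negP => ltu.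
have : (2 * r.+1).-1 * (r.+1 * n + 1) <= (2 * r.+1).-1 * (u + x).
  by rewrite leq_mul2l leU orbT.
have : (2 * r.+1).-1 * (2 * u) <= (2 * r.+1).-1 * n by rewrite leq_mul2l; lia.
by nia.
Qed.

(** Each step adds one set: among the vertices with many neighbors in every old set, many have the
    same trace [Q] on the union of the old sets. Ramsey finds the new independent set [S] among
    these, and the old sets are cut down to parts of [Q]. *)
Lemma exists_joined_system (G : sgraph) k n q s d :
  0 < q -> 0 < k -> 0 < d -> 0 < n -> ~ contains (compl G) (book k n) ->
  q * (n - 1) + 1 <= #|G| ->
  ~ (exists2 S : {set G}, #|S| = s & {in S &, forall x y, x != y -> adj x y}) ->
  2 ^ (q.+1 * ((2 * q * k) ^ q * d) + s + 1) <= n ->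
  exists T : nat -> {set G}, joined_system q d T.
Proof.
move=> q0 k0 d0 n0 nobook leG noclique len.
(* A step costs the factor [2 q k] required by [card_many_nbrs]; after [q] steps the size is [d]. *)
pose t j := (2 * q * k) ^ (q - j) * d.
suff build : forall j, j <= q -> exists T : nat -> {set G}, joined_system j (t j) T.
  by have := build q (leqnn q); rewrite /t subnn expn0 mul1n.
have base0 : 0 < 2 * q * k by rewrite !muln_gt0 q0 k0.
have let0 j : t j <= (2 * q * k) ^ q * d.
  by rewrite leq_pmul2r // leq_pexp2l //; lia.
elim=> [_|j IHj ltj]; first by exists (fun=> set0); split=> [i|i i']; rewrite ltn0.
have [T sysT] := IHj (ltnW ltj).
have tS : t j = 2 * q * k * t j.+1.
  by rewrite /t -(subnSK ltj) expnS mulnA.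
have tS0 : 0 < t j.+1 by rewrite muln_gt0 expn_gt0 base0.
have [Tsize Tjoin] := sysT.
have leU : n <= 2 * #|[set w | [forall i : 'I_j, t j.+1 <= #|T i :&: nbrs w|]]|.
  by apply: (card_many_nbrs (k := k) (q := q)) => //; rewrite -tS.
set U := [set w | _] in leU.
pose Z := \bigcup_(i < j) T i.
have leZ : #|Z| <= q * ((2 * q * k) ^ q * d).
  apply: (@leq_trans (\sum_(i < j) t j)).
    apply: leq_trans (card_bigcup_leq _) _; apply: leq_sum => i _.
    by have [-> _] := Tsize i (ltn_ord i).
  by rewrite sum_nat_const card_ord leq_mul // ltnW.
(* Of the [q.+1] copies of [(2 q k) ^ q d] in the exponent, [q] bound [#|Z|] and one bounds
   [t j.+1]; the final [1] pays for the factor 2 in [leU]. *)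
have ltU : 2 ^ #|Z| * (2 ^ (s + t j.+1) - 1) < #|U|.
  have : 2 ^ (#|Z| + (s + t j.+1) + 1) <= n.
    apply: leq_trans len; rewrite leq_pexp2l //.
    by rewrite mulSn; have := let0 j.+1; move: (t _) (_ ^ _ * _) leZ => u v; nia.
  have := expn_gt0 2 #|Z|; have := expn_gt0 2 (s + t j.+1).
  by rewrite (expnD 2 _ 1) (expnD 2 #|Z|) expn1 mulnBr muln1; lia.
have [Q ltQ] := pigeonhole_fiber (phi := fun w => Z :&: nbrs w)
  (fun w _ => subsetIl _ _) ltU.
set F := [set w in U | _] in ltQ.
have leF : 2 ^ (s + t j.+1) <= #|F| by lia.
have [[S _ [cS cl]]|[S SF [cS ind]]] := ramsey_pow2 leF.
  by case: noclique; exists S.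
have TQ i : i < j -> t j.+1 <= #|T i :&: Q|.
  move=> ij; have /card_gt0P[w wS] : 0 < #|S| by lia.
  have := subsetP SF w wS; rewrite !inE => /andP[/forallP/(_ (Ordinal ij))/= le /eqP <-].
  rewrite setIA (setIidPl (_ : T i \subset Z)) //.
  by apply: (bigcup_sup (Ordinal ij)).
pose T' i := if i < j then first_of (t j.+1) (T i :&: Q) else S.
have T'T i : i < j -> T' i \subset T i :&: Q by rewrite /T' => ->; apply: first_of_sub.
have joinS i : i < j -> fully_joined (T' i) S.
  move=> ij x w /(subsetP (T'T i ij)); rewrite inE => /andP[_ xQ] /(subsetP SF).
  rewrite !inE => /andP[_ /eqP eqQ]; move: xQ; rewrite -eqQ !inE adj_sym.
  by case/andP.
exists T'; split=> [i ltij|i i' lti lti' neq x y].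
  have [ij|ji] := ltnP i j; last by rewrite /T' ltnNge ji.
  split; first by rewrite /T' ij card_first_of ?TQ.
  have [_ indT] := Tsize i ij.
  by move=> x y /(subsetP (T'T i ij))/setIP[xT _] /(subsetP (T'T i ij))/setIP[yT _]; apply: indT.
have [ij|ji] := ltnP i j; have [ij'|ji'] := ltnP i' j.
- move=> /(subsetP (T'T i ij))/setIP[xT _] /(subsetP (T'T i' ij'))/setIP[yT _].
  exact: (Tjoin i i').
- by rewrite {2}/T' ltnNge ji'; apply: joinS.
- by rewrite {1}/T' ltnNge ji /= => xS yT; rewrite adj_sym; apply: (joinS i').
- lia.
Qed.

(** * The averaging argument for the upper bound *)

(** With [m = k (4 a) ^ k b] and [L = 2 a m], the loss caused by [a b] neighbors in one set of size
    [L] is covered by [m] non-neighbors in another. Indeed ['C(m, k)] is at least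
    [(m / 2) ^ k / k!], while ['C(L.-1, k.-1)] is at most [L ^ (k - 1) / (k - 1)!]. *)
Lemma leq_bin_linear_scale a b k :
  0 < a -> 0 < b -> 0 < k ->
  a * b * 'C((2 * a * (k * (4 * a) ^ k * b)).-1, k.-1)
    <= 'C(k * (4 * a) ^ k * b, k).
Proof.
case: k => // k a0 b0 _ /=; set m := k.+1 * _ * b.
have a_gt0 e : 0 < (2 * a) ^ e by rewrite expn_gt0 muln_gt0 a0.
have mE : m = 2 ^ k.+1 * (k.+1 * (2 * a) ^ k.+1 * b).
  rewrite /m (_ : 4 * a = 2 * (2 * a)); last by lia.
  by rewrite expnMn !mulnA (mulnC k.+1).
have le_m : 2 ^ k.+1 * (a * b * k.+1 * (2 * a) ^ k) <= m.
  rewrite mE leq_mul2l (expnS (2 * a)); apply/orP; right.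
  rewrite (_ : _ * _ * b = 2 * (a * b * k.+1 * (2 * a) ^ k)) ?leq_pmull //.
  by move: (_ ^ k) => x; ring.
have lek : 2 * k <= m.
  rewrite mE expnS -mulnA leq_mul2l /=.
  apply: leq_trans (leq_pmull _ _); last by rewrite expn_gt0.
  by move: (a_gt0 k.+1); move: (_ ^ _) => x; nia.
have fact_le : (2 * a * m).-1 ^_ k <= (2 * a * m) ^ k.
  rewrite ffact_prod -[X in _ ^ X]card_ord -prod_nat_const.
  by apply: leq_prod => i _; lia.
have fact_ge : m ^ k.+1 <= 2 ^ k.+1 * m ^_ k.+1.
  rewrite ffact_prod -[X in m ^ X]card_ord -[X in 2 ^ X]card_ord.
  rewrite -!prod_nat_const -big_split /=.
  by apply: leq_prod => i _; have := ltn_ord i; lia.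
have fact0 : 0 < 2 ^ k.+1 * k.+1`! by rewrite muln_gt0 expn_gt0 fact_gt0.
rewrite -(leq_pmul2r fact0) [leqRHS]mulnCA bin_ffact.
apply: leq_trans fact_ge; rewrite factS.
have -> : a * b * 'C((2 * a * m).-1, k) * (2 ^ k.+1 * (k.+1 * k`!))
   = 2 ^ k.+1 * (a * b * k.+1) * ('C((2 * a * m).-1, k) * k`!).
  by move: (2 ^ _) => x; nia.
rewrite bin_ffact; apply: leq_trans (leq_mul (leqnn _) fact_le) _.
rewrite (expnMn (2 * a)) (expnS m) mulnA leq_mul2r -[X in X <= _]mulnA le_m.
by rewrite orbT.
Qed.

(** Otherwise [w] is the part of size 1, and its neighbors in the sets [T i] supply the other parts,
    as [a * b] is at least both [a] and [b]. *)
Lemma nbrs_sparse_in_some (G : sgraph) q d a b (T : nat -> {set G}) w :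
  0 < q -> 0 < a -> 0 < b -> joined_system q d T ->
  ~ contains G (complete_multipartite [:: 1, a & nseq (q - 1) b]) ->
  exists i : 'I_q, #|T i :&: nbrs w| < a * b.
Proof.
move=> q0 a0 b0 [_ joinT] noH; apply/existsP; apply: contra_notT noH.
move=> /existsPn dense.
have denseT i : i < q -> a * b <= #|T i :&: nbrs w|.
  by move=> iq; have := dense (Ordinal iq); rewrite -leqNgt.
pose A i := if i is i'.+1 then T i' :&: nbrs w else [set w].
apply: (@contains_multipartite _ _ A) => /=; rewrite size_nseq.
  case=> [|[|i]] lti /=; first by rewrite cards1.
    by apply: leq_trans (denseT 0 q0); rewrite leq_pmulr.
  rewrite nth_nseq; case: ifP => // _.
  by apply: leq_trans (denseT _ _); rewrite ?leq_pmull //; lia.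
move=> [|i] [|j] //= ltij x y.
  by move=> /set1P-> /setIP[_]; rewrite inE.
by move=> /setIP[xT _] /setIP[yT _]; apply: (joinT i j) => //; lia.
Qed.

(** If [U] had [a] vertices, these together would miss at most [a m] of the [2 a m] vertices of each
    other [T j]. The [b] common neighbors left there, with [t] and the [a] vertices, would form the
    forbidden graph. *)
Lemma leq_perfect_nbrs (G : sgraph) q a b m (T : nat -> {set G}) i t
    (U : {set G}) :
  i < q -> 0 < a -> a * m + b <= 2 * a * m ->
  joined_system q (2 * a * m) T ->
  ~ contains G (complete_multipartite [:: 1, a & nseq (q - 1) b]) ->
  t \in T i -> U \subset nbrs t ->
  (forall u j, u \in U -> j < q -> j != i -> #|T j :\: nbrs u| <= m) ->
  #|U| <= a - 1.
Proof.
move=> iq a0 leb [sizeT joinT] noH tT Ut perf.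
rewrite leqNgt; apply: contra_notN noH => ltU.
have cA : #|first_of a U| = a by apply: card_first_of; lia.
have AU u : u \in first_of a U -> u \in U by apply: subsetP (first_of_sub _ _) u.
(* [bump i] enumerates the indices other than [i]. *)
pose A r := match r with
  | 0 => [set t] | 1 => first_of a U
  | r'.+2 => T (bump i r') :&: [set x | [forall u in first_of a U, adj x u]] end.
have bumpq r : r < q - 1 -> bump i r < q by rewrite /bump; case: (i <= r); lia.
apply: (@contains_multipartite _ _ A) => /=; rewrite size_nseq.
  case=> [|[|r]] ltr /=; rewrite ?cards1 ?cA //.
  rewrite nth_nseq; case: ifP => // ltrq; set j := bump i r.
  have [cT _] := sizeT j (bumpq r ltrq).
  set X := _ :&: _.
  have : #|T j :\: X| <= a * m.
    apply: (@leq_trans #|\bigcup_(u : {u | u \in first_of a U}) (T j :\: nbrs (val u))|).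
      apply/subset_leq_card/subsetP => x; rewrite !inE => /andP[+ xT].
      rewrite xT /= => /forall_inPn[u uA nadj]; apply/bigcupP; exists (Sub u uA) => //.
      by rewrite !inE xT adj_sym nadj.
    apply: leq_trans (card_bigcup_leq _) _.
    apply: (@leq_trans (\sum_(u : {u | u \in first_of a U}) m)).
      apply: leq_sum => u _; apply: perf (bumpq r ltrq) _; last by rewrite eq_sym neq_bump.
      exact: AU (valP u).
    by rewrite sum_nat_const card_sig -[X in _ <= X * _]cA leq_mul2r cardE -cardE leqnn orbT.
  have := cardsID X (T j); rewrite cT (setIidPr (subsetIl _ _ : X \subset T j)); lia.
move=> r s /andP[+ lts]; case: s lts => [|[|s]] lts; case: r => [|[|r]] // ltrs x y.
- by move=> /set1P-> /AU/(subsetP Ut); rewrite inE.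
- move=> /set1P-> /setIP[yT _]; apply: (joinT i (bump i s)) => //; last exact: neq_bump.
  by apply: bumpq; lia.
- by move=> xA /setIP[_]; rewrite inE => /forall_inP/(_ x xA); rewrite adj_sym.
move=> /setIP[xT _] /setIP[yT _]; apply: (joinT (bump i r) (bump i s)) => //.
- by apply: bumpq; lia.
- by apply: bumpq; lia.
- by rewrite (inj_eq (can_inj (bumpK i))); lia.
Qed.

Lemma card_joined_system (G : sgraph) k n q a b (T : nat -> {set G}) :
  0 < k -> 0 < n -> 0 < q -> 0 < a -> 0 < b ->
  ~ contains (compl G) (book k n) ->
  ~ contains G (complete_multipartite [:: 1, a & nseq (q - 1) b]) ->
  joined_system q (2 * a * (k * (4 * a) ^ k * b)) T ->
  #|G| <= q * (n - 1) + k * q * (a - 1).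
Proof.
move=> k0 n0 q0 a0 b0 nobook noH; set m := k * _ * b => sysT.
have bin_m := leq_bin_linear_scale a0 b0 k0; rewrite -/m in bin_m.
have w_gt0 : 0 < (4 * a) ^ k by rewrite expn_gt0 muln_gt0 a0.
have le_km : k <= m by rewrite /m -mulnA leq_pmulr // muln_gt0 w_gt0.
have le_bm : b <= a * m.
  apply: (@leq_trans m); first by rewrite leq_pmull // muln_gt0 k0.
  by rewrite leq_pmull.
have [iota sparse] := fin_all_exists (fun w => nbrs_sparse_in_some w q0 a0 b0 sysT noH).
pose perfect w := [forall j : 'I_q, (j != iota w) ==> (#|T j :\: nbrs w| < m)].
have [sizeT joinT] := sysT; set L := 2 * a * m in sizeT joinT bin_m.
have lekL : k <= L by apply: leq_trans le_km _; rewrite leq_pmull // muln_gt0.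
have bin_sub d : 'C(L, k) <= 'C(L - d, k) + d * 'C(L.-1, k.-1).
  by rewrite -(prednK k0); apply: bin_sub_geq.
have bin_diag : L * 'C(L.-1, k.-1) = k * 'C(L, k).
  by rewrite -[in RHS](prednK k0) mul_bin_diag prednK.
have cT (i : 'I_q) : #|T i| = L by have [] := sizeT i (ltn_ord i).
have cTD (i : 'I_q) w : #|T i :\: nbrs w| = L - #|T i :&: nbrs w|.
  by rewrite -(cT i) -(cardsID (nbrs w) (T i)) addKn.
(* All averages are scaled by ['C(L, k)]. If [w] is not perfect, a term of at least ['C(m, k)] from
   another set makes up the loss at [iota w]. *)
have pointwise w : 'C(L, k) <= \sum_(i < q) 'C(#|T i :\: nbrs w|, k)
    + (if perfect w then #|T (iota w) :&: nbrs w| else 0) * 'C(L.-1, k.-1).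
  have le_iota := bin_sub #|T (iota w) :&: nbrs w|.
  rewrite (bigD1 (iota w)) //= cTD; case: ifP => [_|/negbT]; first lia.
  case/forallPn => j; rewrite negb_imply -leqNgt => /andP[neq le_m].
  rewrite (bigD1 j) //=; have := leq_bin2l k le_m.
  have : #|T (iota w) :&: nbrs w| * 'C(L.-1, k.-1) <= a * b * 'C(L.-1, k.-1).
    by rewrite leq_mul2r ltnW ?orbT // sparse.
  by move: bin_m => /=; lia.
have perfect_nbrs (i : 'I_q) t : t \in T i ->
    #|[set w | perfect w & (iota w == i) && (t \in nbrs w)]| <= a - 1.
  move=> tT; apply: (leq_perfect_nbrs (ltn_ord i) a0 _ sysT noH tT); first lia.
    by apply/subsetP => w; rewrite !inE => /and3P[_ _]; rewrite adj_sym.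
  move=> u j; rewrite !inE => /and3P[/forallP perf /eqP <- _] jq neq.
  by apply/ltnW; apply: (implyP (perf (Ordinal jq))).
have card_nbrs (i : 'I_q) w : #|T i :&: nbrs w| = \sum_(t in T i) (t \in nbrs w).
  rewrite -sum1_card big_mkcond [RHS]big_mkcond; apply: eq_bigr => t _.
  by rewrite inE; case: (t \in T i); case: (t \in nbrs w).
(* The edges between [T i] and the perfect vertices assigned to [i] are counted from the side of
   [T i]. *)
have sum_perfect :
    \sum_w (if perfect w then #|T (iota w) :&: nbrs w| else 0) <= q * (L * (a - 1)).
  rewrite -big_mkcond /= (partition_big iota predT) //=.
  rewrite -[q in q * _]card_ord -sum_nat_const; apply: leq_sum => i _.
  rewrite -(cT i) -sum_nat_const.
  under eq_bigr => w /andP[_ /eqP ->] do rewrite card_nbrs.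
  rewrite exchange_big /=; apply: leq_sum => t tT.
  apply: leq_trans (perfect_nbrs i t tT).
  rewrite -sum1_card big_mkcond [leqRHS]big_mkcond /=.
  apply: leq_sum => w _; rewrite inE.
  by case: (perfect w) => //=; case: (_ == _).
have sum_bins :
    \sum_w \sum_(i < q) 'C(#|T i :\: nbrs w|, k) <= q * ((n - 1) * 'C(L, k)).
  rewrite exchange_big -[q in q * _]card_ord -sum_nat_const; apply: leq_sum => i _.
  by rewrite -(cT i); apply: sum_bin_nonnbrs => //; have [] := sizeT i (ltn_ord i).
have C0 : 0 < 'C(L, k) by rewrite bin_gt0.
rewrite -(leq_pmul2r C0) -sum_nat_const.
apply: leq_trans (leq_sum _ _) _; first by move=> w _; apply: pointwise.
rewrite big_split -big_distrl /= mulnDl; apply: leq_add; first by rewrite -mulnA.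
apply: leq_trans (leq_mul sum_perfect (leqnn _)) _.
(* Absorbing [L] into the binomial turns the total loss [q L (a - 1) 'C(L.-1, k.-1)] into
   [k q (a - 1) 'C(L, k)]. *)
rewrite (mulnC L) mulnA -(mulnA _ L) bin_diag.
by apply/eq_leq; rewrite -!mulnA; ring.
Qed.

Lemma card_complete_multipartite s : #|complete_multipartite s| = sumn s.
Proof.
rewrite card_tagged !sumnE big_map big_enum [RHS](big_nth 0) big_mkord /=.
by apply: eq_bigr => i _; rewrite card_ord.
Qed.

(** The exponent is kept linear in [b]. Its summand [(a + q + 1) * b] accounts for the order of the
    multipartite graph, since a clique of that order contains it. *)
Lemma arrows_multipartite_book k a b n q :
  0 < k -> 0 < n -> 0 < q -> 0 < a -> 0 < b ->
  2 ^ ((q.+1 * ((2 * q * k) ^ q * (2 * a * (k * (4 * a) ^ k))) + (a + q + 1)) * b) <= n ->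
  arrows (q * (n - 1) + k * q * (a - 1) + 1)
    (complete_multipartite [:: 1, a & nseq (q - 1) b]) (book k n).
Proof.
move=> k0 n0 q0 a0 b0 len G cG.
have [hasH|noH] := EM (contains G (complete_multipartite [:: 1, a & nseq (q - 1) b])).
  by left.
right; apply/not_notP => nobook.
have [||||T sysT] := @exists_joined_system G k n q (sumn [:: 1, a & nseq (q - 1) b])
  (2 * a * (k * (4 * a) ^ k * b)) q0 k0 _ n0 nobook.
- by rewrite !muln_gt0 expn_gt0 muln_gt0 k0 a0 b0.
- by rewrite cG leq_add2r leq_addr.
- case=> S cS cl; apply: noH; apply: contains_clique cl.
  by rewrite cS card_complete_multipartite.
- apply: leq_trans len; rewrite leq_pexp2l //= sumn_nseq.
  rewrite mulnDl -addnA; apply: leq_add; last by nia.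
  by apply/eq_leq; rewrite !mulnA.
by have := card_joined_system k0 n0 q0 a0 b0 nobook noH sysT; lia.
Qed.

(** * The lower bound: monotonicity and the extremal graph *)

Section Induced.
Variables (G : sgraph) (A : {set G}).

Definition induced_adj : rel {x | x \in A} := fun u v => adj (val u) (val v).

Lemma induced_adj_sym : symmetric induced_adj.
Proof. by move=> u v; rewrite /induced_adj adj_sym. Qed.

Lemma induced_adj_irr : irreflexive induced_adj.
Proof. by move=> u; rewrite /induced_adj adj_irr. Qed.

Definition induced : sgraph := SGraph induced_adj_sym induced_adj_irr.
End Induced.

Lemma arrows_leq N M (H1 H2 : sgraph) : N <= M -> arrows N H1 H2 -> arrows M H1 H2.
Proof.
move=> leNM arr G cG; pose A := first_of N [set: G].
have cA : #|induced A| = N by rewrite card_sig card_first_of // cardsT cG.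
case: (arr _ cA) => [[f f_inj fadj]|[f f_inj fadj]]; [left|right];
  exists (val \o f); try exact: inj_comp val_inj f_inj; move=> x y /fadj //=.
Qed.

(* A vertex [(i, (x, y))] lies in block [i] and in the [x]-th copy of [K_a] there. *)
Section JoinedCliques.
Variables q c a : nat.

Definition joined_cliques_adj : rel ('I_q * ('I_c * 'I_a)) :=
  fun u v => (u.1 != v.1) || (u.2.1 == v.2.1) && (u.2.2 != v.2.2).

Lemma joined_cliques_adj_sym : symmetric joined_cliques_adj.
Proof.
by move=> u v; rewrite /joined_cliques_adj eq_sym (eq_sym u.2.1) (eq_sym u.2.2).
Qed.

Lemma joined_cliques_adj_irr : irreflexive joined_cliques_adj.
Proof. by move=> u; rewrite /joined_cliques_adj !eqxx. Qed.

Definition joined_cliques : sgraph :=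
  SGraph joined_cliques_adj_sym joined_cliques_adj_irr.

Lemma card_joined_cliques : #|joined_cliques| = q * (c * a).
Proof. by rewrite /= !card_prod !card_ord. Qed.

Lemma nadj_joined_cliques (u v : joined_cliques) :
  u != v -> ~~ adj u v -> u.1 = v.1 /\ u.2.1 != v.2.1.
Proof.
case: u v => [i [x y]] [j [x' y']] /=; rewrite /joined_cliques_adj /= negb_or negbK.
move=> neq /andP[/eqP eqi nadj]; split=> //; subst j.
by apply: contraNneq nadj => eqx; move: neq; rewrite eqx !xpair_eqE !eqxx.
Qed.

(** In the complement, each block is complete [c]-partite with parts of size [a], and no edges run
    between blocks. The spine occupies [k] parts of one block, so the pages must fit into the other
    [c - k] parts. *)
Lemma book_notin_joined_cliques k n : 0 < k -> k < n -> (c - k) * a < n - k ->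
  ~ contains (compl joined_cliques) (book k n).
Proof.
move=> k0 ltkn ltn [f f_inj fadj].
have spine (i j : 'I_n) : i != j -> i < k ->
    (f i).1 = (f j).1 /\ (f i).2.1 != (f j).2.1.
  move=> neq ik; have /fadj/andP[ne nadj] : @adj (book k n) i j.
    by rewrite /= /book_adj neq ik.
  exact: nadj_joined_cliques.
pose o := Ordinal (ltn_trans k0 ltkn).
pose w (i : 'I_k) := widen_ord (ltnW ltkn) i.
pose X := [set (f (w i)).2.1 | i : 'I_k].
have cX : #|X| = k.
  rewrite card_imset ?card_ord // => i j; apply: contra_eq => neq.
  by have [] := spine (w i) (w j) neq (ltn_ord i).
pose P := [set i : 'I_n | k <= i].
have cP : #|P| = n - k.
  transitivity (\sum_(k <= i < n) 1); last by rewrite sum_nat_const_nat muln1.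
  by rewrite big_geq_mkord sum1dep_card.
have g_inj : {in P &, injective (fun i => (f i).2)}.
  move=> i j; rewrite !inE => ki kj eq2; apply: f_inj.
  have one (l : 'I_n) : k <= l -> (f o).1 = (f l).1.
    by move=> kl; have [] := spine o l => //; rewrite -val_eqE /=; lia.
  by rewrite [LHS]surjective_pairing [RHS]surjective_pairing eq2 -(one i) // -(one j).
have : #|P| <= #|setX (~: X) [set: 'I_a]|.
  rewrite -(card_in_imset g_inj); apply/subset_leq_card/subsetP => z.
  case/imsetP => i; rewrite inE => ki ->; rewrite !inE andbT.
  apply/imsetP => -[j _ eqx]; have [] := spine (w j) i _ (ltn_ord j).
    by rewrite -val_eqE /=; have := ltn_ord j; lia.
  by rewrite eqx eqxx.
by rewrite cardsX cardsT card_ord cP cardsCs setCK cX card_ord leqNgt ltn.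
Qed.

(** Let [B i] be the vertices embedded into block [i]. If [B i] meets two parts, it lies in a single
    copy of [K_a]; otherwise it lies in one part. By pigeonhole, some block meets two of the [q + 1]
    parts, so at most [a + (q - 1) * maxn a b] vertices fit, one too few. *)
Lemma multipartite_notin_joined_cliques b : 0 < a -> 0 < q ->
  q = 1 \/ a <= b -> 0 < b ->
  ~ contains joined_cliques (complete_multipartite [:: 1, a & nseq (q - 1) b]).
Proof.
move=> a0 q0 ab b0 [f f_inj fadj]; set s := [:: 1, a & _] in f f_inj fadj *.
have size_s : size s = q.+1 by rewrite /= size_nseq; lia.
have nth_s (i : 'I_(size s)) : 0 < nth 0 s i <= maxn a b.
  case: i => -[|[|i]] /=; rewrite ?size_nseq => lti; try lia.
  by rewrite nth_nseq; case: ifP; lia.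
pose B (i : 'I_q) := [set u | (f u).1 == i].
have multi i u v : u \in B i -> v \in B i -> tag u != tag v -> #|B i| <= a.
  have near x y : x \in B i -> y \in B i -> tag x != tag y -> (f x).2.1 = (f y).2.1.
    rewrite !inE => /eqP xi /eqP yi /fadj.
    by rewrite /= /joined_cliques_adj xi yi eqxx /= => /andP[/eqP].
  move=> uB vB neq; have all_near x : x \in B i -> (f x).2.1 = (f u).2.1.
    move=> xB; have [eqt|] := eqVneq (tag x) (tag u); last exact: near.
    by rewrite (near u v) // (near x v) // eqt.
  have inj : {in B i &, injective (fun x => (f x).2.2)}.
    move=> x y xB yB eqy; apply: f_inj.
    have := all_near x xB; have := all_near y yB.
    move: xB yB eqy; rewrite !inE => /eqP + /eqP.
    by case: (f x) (f y) => [? [? ?]] [? [? ?]] /= -> -> -> -> ->.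
  by rewrite -(card_in_imset inj) (leq_trans (max_card _)) // card_ord.
have mono i : #|B i| <= maxn a b.
  have [/exists_inP[u uB /exists_inP[v vB neq]]|/exists_inPn mono] :=
      boolP [exists u in B i, [exists v in B i, tag u != tag v]].
    by rewrite leq_max (multi i u v).
  have [->|[u uB]] := set_0Vmem (B i); first by rewrite cards0.
  have same v : v \in B i -> tag v = tag u.
    by move=> vB; have /exists_inPn/(_ v vB)/negPn/eqP := mono u uB.
  have /andP[_ le_s] := nth_s (tag u); apply: leq_trans le_s.
  pose g (x : 'I_(nth 0 s (tag u))) : complete_multipartite s := Tagged _ x.
  rewrite -[leqRHS]card_ord -cardsT; apply: leq_trans (leq_imset_card g _).
  apply/subset_leq_card/subsetP => -[i' x] vB; apply/imsetP.
  by have /= eqi := same _ vB; subst i'; exists x.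
have [i [u [v [uB vB neq]]]] : exists i u v, [/\ u \in B i, v \in B i & tag u != tag v].
  pose rep (l : 'I_(size s)) : complete_multipartite s :=
    Tagged (fun l : 'I_(size s) => 'I_(nth 0 s l)) (Ordinal (proj1 (andP (nth_s l)))).
  have : ~~ injectiveb (fun l => (f (rep l)).1).
    by apply: contraL isT => /injectiveP/leq_card; rewrite !card_ord size_s ltnn.
  case/injectivePn => l [l' neq eqB].
  by exists (f (rep l)).1, (rep l), (rep l'); rewrite !inE -eqB eqxx.
have : sumn s <= a + (q - 1) * maxn a b.
  rewrite -card_complete_multipartite -sum1_card.
  rewrite (partition_big (fun u => (f u).1) predT) //= (bigD1 i) //=.
  apply: leq_add; first by rewrite sum1dep_card (multi i u v).
  apply: (@leq_trans (\sum_(j < q | j != i) maxn a b)).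
    by apply: leq_sum => j _; rewrite sum1dep_card mono.
  by rewrite sum_nat_const cardC1 card_ord subn1.
rewrite /s /= sumn_nseq; case: ab => [->|ab]; first by lia.
by rewrite (maxn_idPr ab) mulnC; lia.
Qed.
End JoinedCliques.

(** * Ramsey numbers and the logarithmic condition on [b] *)

Lemma ramsey_leq N (H1 H2 : sgraph) : 0 < N -> arrows N H1 H2 -> ramsey H1 H2 <= N.
Proof.
by move=> N0 arr; rewrite /ramsey; case: ex_minnP => m _; apply; rewrite N0; apply/asboolP.
Qed.

Lemma ramsey_gt N (H1 H2 : sgraph) : ~ arrows N H1 H2 -> N < ramsey H1 H2.
Proof.
move=> narr; rewrite ltnNge; apply: contra_notN narr => le_N.
apply: arrows_leq le_N _; rewrite /ramsey.
by case: ex_minnP => m /andP[_ /asboolP].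
Qed.

(** With [n - 1 - k = r a], take [r + k] copies of [K_a] per block: a block has [n - 1 + k (a - 1)]
    vertices, and [r a = n - k - 1] of them are available for the [n - k] pages. *)
Lemma not_arrows_multipartite_book k a b n q :
  0 < k -> k < n -> 0 < q -> 0 < a -> 0 < b ->
  a %| n - 1 - k -> q = 1 \/ a <= b ->
  ~ arrows (q * (n - 1) + k * q * (a - 1))
    (complete_multipartite [:: 1, a & nseq (q - 1) b]) (book k n).
Proof.
move=> k0 ltkn q0 a0 b0 /dvdnP[r nE] ab /(_ (joined_cliques q (r + k) a)).
rewrite card_joined_cliques => -[||].
- have -> : n - 1 = r * a + k by lia.
  by case: a a0 {nE ab} => // a _; rewrite subn1 /=; ring.
- exact: multipartite_notin_joined_cliques.
- by apply: book_notin_joined_cliques => //; rewrite addnK -nE; lia.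
Qed.

Lemma pow2_leq_of_ln (R : realType) C b n : 0 < C -> 0 < n ->
  (b%:R <= C%:R^-1 * ln (n%:R : R))%R -> 2 ^ (C * b) <= n.
Proof.
move=> C0 n0; rewrite mulrC ler_pdivlMr ?ltr0n // => le_ln.
rewrite -(ler_nat R) natrX; apply: (@le_trans _ _ (sequences.expR (C * b)%N%:R)%R).
  rewrite -[((C * b)%N%:R)%R]mulr1 expRM_natl.
  (* The inequality [2 <= e] is [1 + x <= expR x] at [x = 1]. *)
  by apply: lerXn2r; rewrite ?nnegrE ?expR_ge0 ?expR_ge1Dx.
by rewrite -[leRHS]lnK ?posrE ?ltr0n // ler_expR natrM mulrC.
Qed.

(** The equality carries the condition [p = 2 \/ a <= b] because it fails for large [n] when
    [p >= 3] and [b < a]: then the multipartite graph lies in [K_p(1,b,a,...,a)], and the upper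
    bound with [a] and [b] exchanged is smaller. *)
Theorem theorem1p5 (R : realType) (k a p : nat)
    (hk : 1 <= k) (ha : 1 <= a) (hp : 2 <= p) :
  exists2 delta : R, (0 < delta)%R &
  exists n0 : nat, forall n b : nat,
    n0 <= n -> 1 <= b -> (b%:R <= delta * ln (n%:R : R))%R ->
    ramsey (complete_multipartite [:: 1, a & nseq (p - 2) b]) (book k n)
      <= (p - 1) * (n - 1) + k * (p - 1) * (a - 1) + 1
    /\ (a %| n - 1 - k -> p = 2 \/ a <= b ->
        ramsey (complete_multipartite [:: 1, a & nseq (p - 2) b]) (book k n)
          = (p - 1) * (n - 1) + k * (p - 1) * (a - 1) + 1).
Proof.
set q := p - 1; have q0 : 0 < q by rewrite /q; lia.
have -> : p - 2 = q - 1 by rewrite /q; lia.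
pose C := q.+1 * ((2 * q * k) ^ q * (2 * a * (k * (4 * a) ^ k))) + (a + q + 1).
have C0 : 0 < C by rewrite /C; lia.
exists (C%:R^-1)%R; first by rewrite invr_gt0 ltr0n.
(* The threshold [k.+1] keeps [n - 1 - k] from being truncated; any further largeness of [n] follows
   from [1 <= b] and the logarithmic bound. *)
exists k.+1 => n b ltkn b0 le_ln; have n0 : 0 < n by lia.
have upper : ramsey (complete_multipartite [:: 1, a & nseq (q - 1) b]) (book k n)
    <= q * (n - 1) + k * q * (a - 1) + 1.
  apply: ramsey_leq; first by rewrite addn1.
  by apply: arrows_multipartite_book => //; apply: pow2_leq_of_ln le_ln.
split=> // dvd_a ab; apply/eqP; rewrite eqn_leq upper addn1.
apply/ramsey_gt/not_arrows_multipartite_book => //.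
by case: ab => [p2|]; [left; rewrite /q; lia | right].
Qed.
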